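(* (Effective dominated convergence theorem for Lebesgue measure.) Let $\{g_{m,n}\}$ be a computable double sequence of real functions on $\mathbb{R}$ which converges effectively to $\{f_m\}$ as $n\to\infty$. Assume there exists an effectively integrable computable sequence of functions $\{h_m\}$ such that $|g_{m,n}(x)|\le h_m(x)$ for all $m,n,x$. Then $\{g_{m,n}\}$ is effectively integrable, and $\{\int_{\mathbb{R}} g_{m,n}(x)\,dx\}$ converges effectively to $\{\int_{\mathbb{R}} f_m(x)\,dx\}$ as $n$ tends to infinity, effectively in $m$.
   Context: Computability is in the sense of Pour-El and Richards: a sequence of real functions $\{f_n\}$ on $\mathbb{R}$ (indexed possibly by several natural-number indices) is computable if (i) for every computable sequence of reals $\{x_j\}$ the sequence $\{f_n(x_j)\}$ is computable, and (ii) there is a recursive $\alpha(n,L,k)$ such that $|x-y|<2^{-\alpha(n,L,k)}$ and $|x|,|y|\le L$ imply $|f_n(x)-f_n(y)|<2^{-k}$. A double sequence of functions $\{g_{m,n}\}$ converges effectively to $\{f_m\}$ (as $n\to\infty$) if there is a recursive $\alpha(m,L,k)$ such that $n\ge\alpha(m,L,k)$ and $|x|\le L$ imply $|g_{m,n}(x)-f_m(x)|<2^{-k}$. A sequence of reals $\{a_{m,n}\}$ converges effectively to $\{a_m\}$ as $n\to\infty$ effectively in $m$ if there is a recursive $e(m,k)$ with $|a_{m,n}-a_m|<2^{-k}$ for $n\ge e(m,k)$. A computable sequence of functions $\{f_n\}$ is effectively integrable if $\{\int_{[-j,j]} f_n^+\,dx\}$ and $\{\int_{[-j,j]} f_n^-\,dx\}$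 (with $f^+=f\vee0$, $f^-=(-f)\vee 0$) converge effectively to finite limits as $j\to\infty$, effectively in $n$; then $\int_{\mathbb{R}} f_n\,dx$ is the difference of these limits. *)

(* Defs.v *)
From HB Require Import structures.
From mathcomp Require Import all_boot all_order all_algebra.
From mathcomp Require Import all_classical all_reals all_analysis.
Set Implicit Arguments.
Unset Strict Implicit.
Unset Printing Implicit Defensive.
Import Order.TTheory GRing.Theory Num.Theory.
Import numFieldNormedType.Exports.
Local Open Scope classical_set_scope.
Local Open Scope ring_scope.

(* The smallest class of total functions containing the initial functions and
   closed under composition, primitive recursion and minimization of regular
   functions; it consists exactly of the total computable functions.
   A function of d arguments takes a d.-tuple.  In [rec_prim] and [rec_min]
   the recursion variable and the searched variable come first. *)
Inductive recursive : forall d : nat, (d.-tuple nat -> nat) -> Prop :=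
| rec_zero d : recursive (fun _ : d.-tuple nat => 0%N)
| rec_succ : recursive (fun v : 1.-tuple nat => (tnth v ord0).+1)
| rec_proj d (i : 'I_d) : recursive (fun v : d.-tuple nat => tnth v i)
| rec_comp d e (f : e.-tuple nat -> nat) (g : 'I_e -> d.-tuple nat -> nat) :
    recursive f -> (forall i, recursive (g i)) ->
    recursive (fun v => f [tuple g i v | i < e])
| rec_prim d (f : d.-tuple nat -> nat) (g : d.+2.-tuple nat -> nat)
    (h : d.+1.-tuple nat -> nat) :
    recursive f -> recursive g ->
    (forall v : d.-tuple nat, h [tuple of 0%N :: v] = f v) ->
    (forall n (v : d.-tuple nat),
       h [tuple of n.+1 :: v] = g [tuple of n :: h [tuple of n :: v] :: v]) ->
    recursive h
| rec_min d (f : d.+1.-tuple nat -> nat) (h : d.-tuple nat -> nat) :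
    recursive f ->
    (forall v : d.-tuple nat, f [tuple of h v :: v] = 0%N) ->
    (forall (v : d.-tuple nat) n,
       (n < h v)%N -> f [tuple of n :: v] <> 0%N) ->
    recursive h
| rec_ext d (f g : d.-tuple nat -> nat) :
    recursive f -> f =1 g -> recursive g.

(* Sequences with d natural-number indices are functions on d.-tuple nat. *)
Definition idx1 (T : Type) (f : nat -> T) (v : 1.-tuple nat) : T :=
  f (tnth v ord0).

Definition idx2 (T : Type) (g : nat -> nat -> T) (v : 2.-tuple nat) : T :=
  g (tnth v ord0) (tnth v ord_max).

Definition computable_rat_seq d (r : d.-tuple nat -> rat) : Prop :=
  exists a b s : d.-tuple nat -> nat,
    [/\ recursive a, recursive b & recursive s] /\
    forall v, b v <> 0%N /\ r v = (-1) ^+ s v * ((a v)%:R / (b v)%:R).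

(* a n j converges to l n as j tends to infinity, effectively in n. *)
Definition eff_cvg (R : realType) d
    (a : d.-tuple nat -> nat -> R) (l : d.-tuple nat -> R) : Prop :=
  exists e : d.+1.-tuple nat -> nat, recursive e /\
    forall (n : d.-tuple nat) (k j : nat),
      (e [tuple of k :: n] <= j)%N -> `|a n j - l n| < 2 ^- k.

Definition computable_real_seq (R : realType) d
    (x : d.-tuple nat -> R) : Prop :=
  exists r : d.+1.-tuple nat -> rat, computable_rat_seq r /\
    eff_cvg (fun n k => ratr (r [tuple of k :: n])) x.

Definition seq_computable (R : realType) d
    (f : d.-tuple nat -> R -> R) : Prop :=
  forall x : nat -> R, computable_real_seq (idx1 x) ->
    computable_real_seq
      (fun v : d.+1.-tuple nat => f [tuple of behead v] (x (thead v))).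

Definition eff_unif_continuous (R : realType) d
    (f : d.-tuple nat -> R -> R) : Prop :=
  exists alpha : d.+2.-tuple nat -> nat, recursive alpha /\
    forall (n : d.-tuple nat) (L k : nat) (x y : R),
      `|x - y| < 2 ^- alpha [tuple of L :: k :: n] ->
      `|x| <= L%:R -> `|y| <= L%:R -> `|f n x - f n y| < 2 ^- k.

Definition computable_fun_seq (R : realType) d
    (f : d.-tuple nat -> R -> R) : Prop :=
  seq_computable f /\ eff_unif_continuous f.

Definition eff_cvg_fun (R : realType)
    (g : nat -> nat -> R -> R) (f : nat -> R -> R) : Prop :=
  exists alpha : 3.-tuple nat -> nat, recursive alpha /\
    forall (m L k n : nat) (x : R),
      (alpha [tuple m; L; k] <= n)%N -> `|x| <= L%:R ->
      `|g m n x - f m x| < 2 ^- k.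

Definition trunc_integral (R : realType) (f : R -> R) (j : nat) : R :=
  \int[@lebesgue_measure R]_(x in `[- j%:R, j%:R]) f x.

Definition eff_integrable (R : realType) d
    (f : d.-tuple nat -> R -> R) : Prop :=
  exists p q : d.-tuple nat -> R,
    eff_cvg (fun n => trunc_integral (f n)^\+) p /\
    eff_cvg (fun n => trunc_integral (f n)^\-) q.

(* Meaningful only when both limits exist: [lim] is total. *)
Definition integralR (R : realType) (f : R -> R) : R :=
  lim (trunc_integral f^\+ @ \oo) - lim (trunc_integral f^\- @ \oo).

(* Main.v *)
Require Import Defs.
From HB Require Import structures.
From mathcomp Require Import all_boot all_order all_algebra.
From mathcomp Require Import all_classical all_reals all_analysis.
From mathcomp Require Import measurable_realfun lra.
Import Order.TTheory GRing.Theory Num.Theory.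
Import numFieldNormedType.Exports.
Local Open Scope classical_set_scope.
Local Open Scope ring_scope.

(** Since [|g m n|] and [|f m|] are at most [h m], the tail outside [[-L, L]] of
    the integral of each of their positive and negative parts is at most that
    of [h m], which is effectively small.  This alone gives effective
    integrability.  For the limit, choose [L] with tail below [2^-(k+3)], then
    [n] so large that [|g m n - f m| <= 2^-(k+3+L)] on [[-L, L]]; since
    [2 L / 2^L <= 2], each part contributes less than [4 * 2^-(k+3)]. *)

(** * Closure of recursive functions under small compositions and addition *)

Lemma recursive_comp1 d (f : 1.-tuple nat -> nat) (a : d.-tuple nat -> nat) :
  recursive f -> recursive a -> recursive (fun v => f [tuple a v]).
Proof.
move=> rf ra; apply: rec_ext (rec_comp rf (fun=> ra)) _ => v /=.
by congr f; apply: eq_from_tnth => i; rewrite tnth_mktuple ord1.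
Qed.

Lemma recursive_comp2 d (f : 2.-tuple nat -> nat) (a b : d.-tuple nat -> nat) :
  recursive f -> recursive a -> recursive b ->
  recursive (fun v => f [tuple a v; b v]).
Proof.
move=> rf ra rb.
have rg i : recursive (tnth [tuple a; b] i) by case: i => [[|[]]].
apply: rec_ext (rec_comp rf rg) _ => v /=.
congr f; apply: eq_from_tnth => i; rewrite tnth_mktuple.
by case: i => [[|[]]].
Qed.

Lemma recursive_comp3 d (f : 3.-tuple nat -> nat)
    (a b c : d.-tuple nat -> nat) :
  recursive f -> recursive a -> recursive b -> recursive c ->
  recursive (fun v => f [tuple a v; b v; c v]).
Proof.
move=> rf ra rb rc.
have rg i : recursive (tnth [tuple a; b; c] i) by case: i => [[|[|[]]]].
apply: rec_ext (rec_comp rf rg) _ => v /=.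
congr f; apply: eq_from_tnth => i; rewrite tnth_mktuple.
by case: i => [[|[|[]]]].
Qed.

Lemma recursive_succ d (a : d.-tuple nat -> nat) :
  recursive a -> recursive (fun v => (a v).+1).
Proof. exact: recursive_comp1 rec_succ. Qed.

Lemma recursive_add d (a b : d.-tuple nat -> nat) :
  recursive a -> recursive b -> recursive (fun v => (a v + b v)%N).
Proof.
move=> ra rb.
have add2 :
    recursive (fun v : 2.-tuple nat => (tnth v ord0 + tnth v ord_max)%N).
  (* Recursion on the first summand: component 1 of the step's argument holds the previous value,
     whose successor is taken. *)
  apply: (@rec_prim 1 _ (fun v => (tnth v (inord 1)).+1) _ (rec_proj ord0)).
  - exact/recursive_succ/rec_proj.
  - by move=> v; rewrite !(tnth_nth 0%N).
  - by move=> n v; rewrite !(tnth_nth 0%N) inordK.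
by apply: rec_ext (recursive_comp2 _ _ _ _ add2 ra rb) _ => v.
Qed.

(** * Integrals over the symmetric intervals [[-j, j]] *)

Section truncated_integrals.
Set Implicit Arguments.
Unset Strict Implicit.
Context {R : realType}.
Implicit Types (F G H : R -> R).
Local Notation mu := (@lebesgue_measure R).
Local Notation sym j := (`[- j%:R, j%:R]%classic : set R).

Lemma exp2VP (e : R) : 0 < e -> exists k, 2 ^- k < e :> R.
Proof.
move=> e0; exists (Num.bound e^-1).
rewrite invf_plt ?posrE ?exprn_gt0 //.
exact: upper_nthrootP.
Qed.

Lemma eff_unif_continuous_continuous d (f : d.-tuple nat -> R -> R) :
  eff_unif_continuous f -> forall n, continuous (f n).
Proof.
move=> [alpha [_ fa]] n x; apply/cvgrPdist_lt => e e0.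
have [k ke] := exp2VP e0.
(* Every [y] within distance 1 of [x] then lies in [[-L, L]], where the modulus applies. *)
pose L := Num.bound (`|x| + 1).
have xL : `|x| + 1 < L%:R by rewrite archi_boundP ?addr_ge0.
near=> y; apply: lt_trans ke; apply: (fa n L k).
- by near: y; apply: cvgr_dist_lt; rewrite ?invr_gt0 ?exprn_gt0.
- by lra.
- have : `|x - y| < 1 by near: y; apply: cvgr_dist_lt.
  have := ler_normD x (y - x); rewrite addrC subrK distrC; lra.
Unshelve. all: by end_near. Qed.

Lemma measurable_sym (j : nat) : @measurable _ (measurableTypeR R) (sym j).
Proof. exact: measurable_itv. Qed.

(** A continuous [H] is integrable on the compact interval, and domination passes this on to [F],
    which is only assumed measurable. *)
Lemma dominated_integrable F H j : measurable_fun setT F -> continuous H ->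
  (forall x, `|F x| <= H x) -> mu.-integrable (sym j) (EFin \o F).
Proof.
move=> mF cH FH.
apply: (@le_integrable _ _ _ mu _ (measurable_sym j) _ (EFin \o H)).
- exact/measurable_EFinP/measurable_funTS.
- by move=> x _ /=; rewrite lee_fin (le_trans (FH x)) ?ler_norm.
- apply: continuous_compact_integrable; first exact: segment_compact.
  exact: continuous_subspaceT.
Qed.

Lemma trunc_integral_nondecreasing F : measurable_fun setT F ->
  (forall j, mu.-integrable (sym j) (EFin \o F)) -> (forall x, 0 <= F x) ->
  {homo trunc_integral F : i j / (i <= j)%N >-> i <= j}.
Proof.
move=> mF iF F0 i j ij; rewrite /trunc_integral /Rintegral fine_le //.
- exact: integrable_fin_num (iF i).
- exact: integrable_fin_num (iF j).
apply: ge0_subset_integral; [exact: measurable_sym|exact: measurable_sym| | |].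
- exact/measurable_EFinP/measurable_funTS.
- by move=> x _; rewrite lee_fin.
- by apply: subset_itvScc; rewrite /= bnd_simp ?lerN2 ler_nat.
Qed.

Lemma integrable_symB F G j :
  mu.-integrable (sym j) (EFin \o F) -> mu.-integrable (sym j) (EFin \o G) ->
  mu.-integrable (sym j) (EFin \o (F \- G)).
Proof. by move=> iF iG; exact: (integrableB (measurable_sym j) iF iG). Qed.

Lemma trunc_integralB F G j :
  mu.-integrable (sym j) (EFin \o F) -> mu.-integrable (sym j) (EFin \o G) ->
  trunc_integral (F \- G) j = trunc_integral F j - trunc_integral G j.
Proof. by move=> iF iG; apply: RintegralB => //; exact: measurable_sym. Qed.

(** Both [F] and [H \- F] are nonnegative, so their truncated integrals increase with the interval.
    Hence [F] gains no more than [H] when the interval grows, and in the limit the tail of [F] is at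
    most that of [H]. *)
Lemma dominated_trunc_integral F H p : measurable_fun setT F ->
  continuous H -> (forall x, 0 <= F x <= H x) ->
  trunc_integral H @ \oo --> p ->
  cvgn (trunc_integral F) /\
  forall j, `|trunc_integral F j - limn (trunc_integral F)| <=
            `|trunc_integral H j - p|.
Proof.
move=> mF cH FH Hp.
have mH : measurable_fun setT H by exact: continuous_measurable_fun.
have F0 x : 0 <= F x by case/andP: (FH x).
have leFH x : F x <= H x by case/andP: (FH x).
have H0 x : 0 <= H x by exact: le_trans (leFH x).
have iF j : mu.-integrable (sym j) (EFin \o F).
  by apply: dominated_integrable cH _ => // x; rewrite ger0_norm.
have iH j : mu.-integrable (sym j) (EFin \o H).
  by apply: dominated_integrable cH _ => // x; rewrite ger0_norm.
have ndF := trunc_integral_nondecreasing mF iF F0.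
have ndH := trunc_integral_nondecreasing mH iH H0.
have ndHF : {homo trunc_integral (H \- F) : i j / (i <= j)%N >-> i <= j}.
  apply: trunc_integral_nondecreasing.
  - exact: measurable_funB.
  - by move=> j; exact: integrable_symB.
  - by move=> x; rewrite subr_ge0.
have limH : limn (trunc_integral H) = p by exact: cvg_lim.
have leHp j : trunc_integral H j <= p.
  by rewrite -limH; apply: nondecreasing_cvgn_le => //; apply/cvg_ex; exists p.
have cF : cvgn (trunc_integral F).
  apply: nondecreasing_is_cvgn => //; exists p => _ [j _ <-].
  apply: le_trans (leHp j); apply: le_Rintegral => //; exact: measurable_sym.
split=> // j; have leF := nondecreasing_cvgn_le ndF cF j.
rewrite distrC ger0_norm ?subr_ge0// distrC ger0_norm ?subr_ge0//.
(* For [i >= j], monotonicity for [H \- F] bounds the integral of [F] up to [i] by its value at [j]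
   plus the gain of [H], which is at most [p] minus the integral of [H] up to [j]. *)
rewrite lerBlDr; apply: limr_le => //; exists j => // i /= ji.
by have := ndHF _ _ ji; rewrite !trunc_integralB //; have := leHp i; lra.
Qed.

Lemma lebesgue_measure_sym j : mu (sym j) = (j%:R *+ 2)%:E.
Proof.
have -> := lebesgue_measure_itv `[- (j%:R : R), j%:R].
(* The measure formula separates the degenerate interval, which occurs here only for [j = 0]. *)
rewrite /= lte_fin; case: ltP => [_|jj]; first by rewrite -EFinB opprK mulr2n.
suff -> : j%:R = 0 :> R by rewrite mul0rn.
by have := ler0n R j; lra.
Qed.

Lemma trunc_integral_dist F G j (e : R) :
  mu.-integrable (sym j) (EFin \o F) -> mu.-integrable (sym j) (EFin \o G) ->
  (forall x, `|x| <= j%:R -> `|F x - G x| <= e) ->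
  `|trunc_integral F j - trunc_integral G j| <= e * (j%:R *+ 2).
Proof.
move=> iF iG FGe.
have mS := measurable_sym j.
have iFG : mu.-integrable (sym j) (EFin \o (F \- G)).
  exact: integrable_symB.
rewrite -trunc_integralB //; apply: le_trans (le_normr_Rintegral mS iFG) _.
apply: (@le_trans _ _ (\int[mu]_(x in sym j) e)).
  apply: le_Rintegral => //.
  - exact: integrable_abse iFG.
  - apply: continuous_compact_integrable; first exact: segment_compact.
    by apply: continuous_subspaceT => ?; exact: cvg_cst.
  - by move=> x /=; rewrite in_itv /= -ler_norml => /FGe.
rewrite (@Rintegral_cst _ _ _ mu _ mS) le_eqVlt; apply/orP; left; apply/eqP.
congr (_ * _); exact: (congr1 fine (lebesgue_measure_sym j)).
Qed.

(** * Positive and negative parts are bounded by the absolute value and 1-Lipschitz *)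

Lemma funrpos_bound F x : 0 <= F^\+ x <= `|F x|.
Proof. by rewrite /funrpos le_max lexx orbT ge_max ler_norm normr_ge0. Qed.

Lemma funrneg_bound F x : 0 <= F^\- x <= `|F x|.
Proof. by rewrite -normrN -funrposN funrpos_bound. Qed.

Lemma funrpos_dist F G x : `|F^\+ x - G^\+ x| <= `|F x - G x|.
Proof.
have := ler_norm (F x - G x); have := ler_norm (G x - F x).
rewrite (distrC (G x)) /funrpos ler_norml.
by case: (leP (F x) 0) => ?; case: (leP (G x) 0) => ?; lra.
Qed.

Lemma funrneg_dist F G x : `|F^\- x - G^\- x| <= `|F x - G x|.
Proof.
by rewrite -!funrposN (le_trans (funrpos_dist _ _ _))//= -opprD normrN.
Qed.

(** * Effective convergence and effective integrability under domination *)

Lemma eff_cvg_cvgn d (a : d.-tuple nat -> nat -> R) l :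
  eff_cvg a l -> forall n, a n @ \oo --> l n.
Proof.
move=> [e [_ ea]] n; apply/cvgrPdist_lt => r r0; have [k kr] := exp2VP r0.
exists (e [tuple of k :: n]) => // j /= /ea.
by rewrite distrC => /lt_trans; exact.
Qed.

(** The modulus of [a] at the [i]-th index also serves [b], since the errors of [b] are no larger.
    This carries the modulus for [h] over to families with other indices. *)
Lemma eff_cvg_reindex d (i : 'I_d) (a : nat -> nat -> R) l
    (b : d.-tuple nat -> nat -> R) q : eff_cvg (idx1 a) (idx1 l) ->
  (forall n j, `|b n j - q n| <= `|a (tnth n i) j - l (tnth n i)|) ->
  eff_cvg b q.
Proof.
move=> [e [re ea]] ba.
(* The accuracy comes first in [v], so the [i]-th index sits at position [lift ord0 i]. *)
exists (fun v => e [tuple tnth v ord0; tnth v (lift ord0 i)]); split.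
  by apply: recursive_comp2 => //; exact: rec_proj.
move=> n k j; rewrite tnth0 tnthS => ej; apply: le_lt_trans (ba _ _) _.
have {}ej : (e [tuple of k :: [tuple tnth n i]] <= j)%N.
  apply: leq_trans ej.
  by rewrite (_ : [tuple of _] = [tuple k; tnth n i]) //; exact: val_inj.
exact: ea ej.
Qed.

Lemma eff_cvg_fun_pointwise (g : nat -> nat -> R -> R) f : eff_cvg_fun g f ->
  forall m x, g m n x @[n --> \oo] --> f m x.
Proof.
move=> [alpha [_ gf]] m x; apply/cvgrPdist_lt => r r0; have [k kr] := exp2VP r0.
have xL : `|x| <= (Num.bound `|x|)%:R by rewrite ltW ?archi_boundP.
exists (alpha [tuple m; Num.bound `|x|; k]) => // n /= /gf /(_ xL).
by rewrite distrC => /lt_trans; exact.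
Qed.

(** Stated for any number of indices, with [i] selecting the index of the dominating function, so as
    to cover both the double sequence and its limit. *)
Lemma eff_integrable_dominated d (i : 'I_d) (h : nat -> R -> R) p
    (u : d.-tuple nat -> R -> R) :
  (forall m, continuous (h m)) ->
  eff_cvg (idx1 (fun m => trunc_integral (h m))) (idx1 p) ->
  (forall n, measurable_fun setT (u n)) ->
  (forall n x, `|u n x| <= h (tnth n i) x) ->
  eff_integrable u.
Proof.
move=> ch hp mu_ uh.
have hc m : trunc_integral (h m) @ \oo --> p m.
  exact: (eff_cvg_cvgn (n := [tuple m]) hp).
exists (fun n => limn (trunc_integral (u n)^\+)).
exists (fun n => limn (trunc_integral (u n)^\-)).
split; apply: (eff_cvg_reindex (i := i) hp) => n j.
- apply: (dominated_trunc_integral _ (ch _) _ (hc _)).2.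
  + exact: measurable_funrpos.
  + move=> x; have /andP[-> ub] := funrpos_bound (u n) x.
    exact: le_trans ub (uh _ _).
- apply: (dominated_trunc_integral _ (ch _) _ (hc _)).2.
  + exact: measurable_funrneg.
  + move=> x; have /andP[-> ub] := funrneg_bound (u n) x.
    exact: le_trans ub (uh _ _).
Qed.

(** * Effective convergence of the integrals *)

Lemma eff_cvg_integralR (g : nat -> nat -> R -> R) (f h : nat -> R -> R) p :
  (forall m, continuous (h m)) ->
  eff_cvg (idx1 (fun m => trunc_integral (h m))) (idx1 p) ->
  (forall m n, measurable_fun setT (g m n)) ->
  (forall m, measurable_fun setT (f m)) ->
  (forall m n x, `|g m n x| <= h m x) -> (forall m x, `|f m x| <= h m x) ->
  eff_cvg_fun g f ->
  eff_cvg (idx1 (fun m n => integralR (g m n)))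
          (idx1 (fun m => integralR (f m))).
Proof.
move=> ch hp mg mf gh fh [alpha [ra gf]].
have hc m : trunc_integral (h m) @ \oo --> p m.
  exact: (eff_cvg_cvgn (n := [tuple m]) hp).
have [e [re he]] := hp.
(* At [(k, m)] this is a radius beyond which [h m] has tail below [2 ^- k.+3]. *)
pose cut (v : 2.-tuple nat) := e [tuple (tnth v ord0).+3; tnth v ord_max].
have rcut : recursive cut.
  by apply: recursive_comp2; [|apply: recursive_succ; apply: recursive_succ;
    apply: recursive_succ|]; [exact: re|exact: rec_proj|exact: rec_proj].
(* The radius is added to the accuracy to offset the length [2 L] of the interval. *)
exists (fun v => alpha [tuple tnth v ord_max; cut v;
                              ((tnth v ord0).+3 + cut v)%N]); split.
  apply: recursive_comp3 => //; first exact: rec_proj.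
  apply: recursive_add => //; do 3!apply: recursive_succ; exact: rec_proj.
move=> v k n; rewrite /idx1; set m := tnth v ord0.
have -> : [tuple of k :: v] = [tuple k; m].
  apply: eq_from_tnth => -[[|[|//]] i]; rewrite !(tnth_nth 0%N) //=.
  by rewrite /m (tnth_nth 0%N).
set L := cut [tuple k; m].
rewrite !(tnth_nth 0%N) /= => nK.
have tail : `|trunc_integral (h m) L - p m| < 2 ^- k.+3.
  apply: (he [tuple m] k.+3 L); rewrite /L /cut !(tnth_nth 0%N) /=.
  by rewrite (_ : [tuple of _] = [tuple k.+3; m]) //; exact: val_inj.
have close x : `|x| <= L%:R -> `|g m n x - f m x| <= 2 ^- (k.+3 + L).
  by move=> xL; rewrite ltW // (gf _ L).
have double i : 2 ^- i.+1 *+ 2 = 2 ^- i :> R.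
  by rewrite exprSr invfM mulr2n -splitr.
(* This reduces to [L <= 2 ^ L]. *)
have small : 2 ^- (k.+3 + L) * (L%:R *+ 2) <= 2 ^- k.+3 *+ 2 :> R.
  rewrite exprD invfM mulrnAr lerMn2r /= -mulrA ler_piMr ?invr_ge0 ?exprn_ge0 //.
  rewrite mulrC ler_pdivrMr ?exprn_gt0 // mul1r -natrX ler_nat.
  exact/ltnW/ltn_expl.
(* Here [s] stands for either the positive or the negative part. With [2 ^- k.+3] as unit, the two
   tails cost less than 1 each and the interval at most 2. *)
have part (s : (R -> R) -> R -> R) :
    (forall F, measurable_fun setT F -> measurable_fun setT (s F)) ->
    (forall F x, 0 <= s F x <= `|F x|) ->
    (forall F G x, `|s F x - s G x| <= `|F x - G x|) ->
    `|limn (trunc_integral (s (g m n))) - limn (trunc_integral (s (f m)))|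
      < 2 ^- k.+3 *+ 4.
  move=> ms sb sd.
  have ub F : (forall x, `|F x| <= h m x) -> forall x, 0 <= s F x <= h m x.
    by move=> Fh x; have /andP[-> /le_trans] := sb F x; exact.
  have [_ /(_ L) tg] :=
    dominated_trunc_integral (ms _ (mg m n)) (ch m) (ub _ (gh m n)) (hc m).
  have [_ /(_ L) tf] :=
    dominated_trunc_integral (ms _ (mf m)) (ch m) (ub _ (fh m)) (hc m).
  have iS F : measurable_fun setT F -> (forall x, `|F x| <= h m x) ->
      mu.-integrable (sym L) (EFin \o s F).
    move=> mF Fh; apply: dominated_integrable (ms _ mF) (ch m) _ => x.
    by have /andP[s0 sh] := ub _ Fh x; rewrite ger0_norm.
  have := trunc_integral_dist (iS _ (mg m n) (gh m n)) (iS _ (mf m) (fh m))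
    (fun x xL => le_trans (sd _ _ x) (close x xL)).
  move: (limn _) (limn _) tail tg tf small => lg lf tail tg tf small.
  move=> /le_trans /(_ small).
  have {}tg := le_lt_trans tg tail; have {}tf := le_lt_trans tf tail.
  move: tg tf; rewrite !ltr_norml !ler_norml; lra.
have /= pos := part (fun F => F^\+) (fun F => @measurable_funrpos _ _ _ _ F)
  funrpos_bound funrpos_dist.
have /= neg := part (fun F => F^\-) (fun F => @measurable_funrneg _ _ _ _ F)
  funrneg_bound funrneg_dist.
(* Now [2 ^- k] is eight units of [2 ^- k.+3], four for each part. *)
rewrite -[2 ^- k]double -double -double /integralR -!mulrnA.
move: pos neg; rewrite !ltr_norml; lra.
Qed.

End truncated_integrals.

(** * Passage of measurability and domination to the limit, and the conclusion *)

Theorem theorem3p4 (R : realType)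
    (g : nat -> nat -> R -> R) (f h : nat -> R -> R)
    (g_comp : computable_fun_seq (idx2 g))
    (g_cvg : eff_cvg_fun g f)
    (h_comp : computable_fun_seq (idx1 h))
    (h_int : eff_integrable (idx1 h))
    (gh : forall (m n : nat) (x : R), `|g m n x| <= h m x) :
  [/\ eff_integrable (idx2 g),
      eff_integrable (idx1 f) &
      eff_cvg (idx1 (fun m n => integralR (g m n)))
              (idx1 (fun m => integralR (f m)))].
Proof.
have ch m : continuous (h m).
  exact: (eff_unif_continuous_continuous (n := [tuple m]) h_comp.2).
have mg m n : measurable_fun setT (g m n).
  apply: continuous_measurable_fun.
  exact: (eff_unif_continuous_continuous (n := [tuple m; n]) g_comp.2).
have h0 m x : 0 <= h m x by exact: le_trans (gh m 0%N x).
have [p [q [hp _]]] := h_int.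
(* Since [h m] bounds an absolute value it is nonnegative and equals its positive part, so [p] is
   the limit of its own truncated integrals. *)
have hpE : eff_cvg (idx1 (fun m => trunc_integral (h m)))
                   (idx1 (fun m => p [tuple m])).
  have [e [re he]] := hp; exists e; split=> // v k j /he.
  rewrite /idx1.
  have -> : [tuple tnth v ord0] = v.
    by apply: eq_from_tnth => i; rewrite [i]ord1.
  suff -> : (h (tnth v ord0))^\+ = h (tnth v ord0) by [].
  by apply/funext => x; rewrite /funrpos; apply/max_idPl.
have fc m x : g m n x @[n --> \oo] --> f m x by exact: eff_cvg_fun_pointwise.
(* Measurability and the bound by [h m] both pass to [f m] through the pointwise limit. *)
have mf m : measurable_fun setT (f m).
  apply: (measurable_fun_cvg (mg m)) => x _; exact: fc.
have fh m x : `|f m x| <= h m x.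
  apply: (cvgr_to_le (cvg_norm (fc m x))).
  by near=> n; exact: gh.
split.
- apply: (@eff_integrable_dominated R 2 ord0 h _ (idx2 g) ch hpE) => v.
    exact: mg.
  exact: gh.
- apply: (@eff_integrable_dominated R 1 ord0 h _ (idx1 f) ch hpE) => v.
    exact: mf.
  exact: fh.
- exact: eff_cvg_integralR ch hpE mg mf gh fh g_cvg.
Unshelve. all: by end_near. Qed.
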